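(* Let $G$ be a discrete group with a fixed finite generating set $S$, acting on a countable set $X$. Suppose there exist an increasing sequence $(K_n)$ of finite subsets exhausting $X$ (i.e. $\bigcup_n K_n=X$) and a sequence $(\epsilon_n)$ decreasing to $0$ such that for each $n$ there exists a probability measure $\nu_n$ of finite support on $G$ such that for any $x,y\in K_n$ such that $y=s\cdot x$ for some $s\in S$, we have \[ \left\Vert \nu_n\cdot x-\nu_n\cdot y\right\Vert_1<\epsilon_n . \] Then there exists a non-degenerate probability measure $\mu$ on $G$ such that $(X,P_\mu)$ is Liouville.
   Context: For a probability measure $\mu$ on $G$, the induced transition matrix on $X$ is $P_\mu(x,y)=\sum_{g\in G}\mathbf{1}_{\{g\cdot x=y\}}\mu(g)$, and $\mu\cdot x$ denotes the probability measure $P_\mu(x,\cdot)$ on $X$. For $f:X\to\mathbb{R}$, $\Vert f\Vert_1=\sum_{x\in X}|f(x)|$. The measure $\mu$ is non-degenerate if its support $\{g\in G:\mu(g)>0\}$ generates the group $G$. A function $f:X\to\mathbb{R}$ is $P_\mu$-harmonic if $f(x)=\sum_{y\in X}f(y)P_\mu(x,y)$ for all $x\in X$, and $(X,P_\mu)$ is Liouville if all bounded $P_\mu$-harmonic functions are constant.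
   Formalization: The action of G on X is additionally assumed transitive; without this the claim fails (e.g. the trivial group acting on two points), since the indicator of an orbit is always a bounded harmonic function. *)

(* Defs.v *)
From HB Require Import structures.
From mathcomp Require Export all_boot all_order all_algebra.
From mathcomp Require Export all_classical all_reals all_analysis.

Set Implicit Arguments.
Unset Strict Implicit.
Unset Printing Implicit Defensive.

Import Order.TTheory GRing.Theory Num.Theory.
Import numFieldNormedType.Exports.

Local Open Scope classical_set_scope.
Local Open Scope ring_scope.

(* The library's [action] structure requires a finite group and writes the
   acting element on the right; [act g x] here is the left action g . x of an
   arbitrary group. *)
Definition is_left_action (G : groupType) (X : Type) (act : G -> X -> X) : Prop :=
  (forall x : X, act 1%g x = x) /\
  (forall (g h : G) (x : X), act (g * h)%g x = act g (act h x)).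

Definition transitive_action (G X : Type) (act : G -> X -> X) : Prop :=
  forall x y : X, exists g : G, act g x = y.

(* Generation as a group: inverses are allowed. *)
Definition generates (G : groupType) (A : set G) : Prop :=
  forall H : set G,
    H 1%g ->
    (forall g h : G, H g -> H h -> H (g * h)%g) ->
    (forall g : G, H g -> H (g^-1)%g) ->
    A `<=` H -> H = [set: G].

(* A probability measure on a discrete group, given by its mass function. *)
Definition is_probability (R : realType) (G : groupType) (mu : G -> R) : Prop :=
  (forall g : G, 0 <= mu g) /\ (\esum_(g in [set: G]) (mu g)%:E = 1)%E.

Definition supp (R : realType) (G : groupType) (mu : G -> R) : set G :=
  [set g | 0 < mu g].

Definition nondegenerate (R : realType) (G : groupType) (mu : G -> R) : Prop :=
  generates (supp mu).

(* [fine] discards nothing when [mu] is a probability: the sum is then at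
   most 1.  The measure mu . x is [induced act mu x]. *)
Definition induced (R : realType) (G : groupType) (X : choiceType)
    (act : G -> X -> X) (mu : G -> R) (x y : X) : R :=
  fine (\esum_(g in [set: G]) ((act g x == y)%:R * mu g)%:E).

Definition l1norm (R : realType) (X : choiceType) (f : X -> R) : \bar R :=
  \esum_(x in [set: X]) (`|f x|)%:E.

(* [\esum] is a supremum of finite sums, meaningful for nonnegative terms only;
   the signed series is therefore required to converge absolutely and is summed
   through its positive and negative parts.  Absolute convergence is automatic
   when [f] is bounded and [mu] is a probability. *)
Definition harmonic (R : realType) (G : groupType) (X : choiceType)
    (act : G -> X -> X) (mu : G -> R) (f : X -> R) : Prop :=
  forall x : X,
    let a := fun y : X => (f y * induced act mu x y)%:E in
    summable [set: X] a /\
    ((f x)%:E = \esum_(y in [set: X]) a^\+ y - \esum_(y in [set: X]) a^\- y)%E.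

Definition liouville (R : realType) (G : groupType) (X : choiceType)
    (act : G -> X -> X) (mu : G -> R) : Prop :=
  forall f : X -> R,
    bounded_fun f -> harmonic act mu f -> forall x y : X, f x = f y.

(* Main.v *)
Require Import Defs.
From mathcomp Require Import ring lra.

Set Implicit Arguments.
Unset Strict Implicit.
Unset Printing Implicit Defensive.

Import Order.TTheory GRing.Theory Num.Theory.
Import numFieldNormedType.Exports.

Local Open Scope classical_set_scope.
Local Open Scope ring_scope.

(** The measure is a mixture [mu = \sum_k c_k beta_k] with [c_k = 2^-(k+1)],
    where [beta_0] is uniform on a finite set containing [S] and the other
    [beta_k] are taken among the almost invariant measures.

    Since [S] generates [G] and the action is transitive, any two points of [X]
    are joined by a path of [S]-steps, which lies in [K_n] for large [n]; by the
    triangle inequality the almost invariant measures of large index therefore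
    equalize any prescribed finite set of points up to any prescribed error
    ([near_l1dist_seq]).

    Let [n] be given and let [T] be a finite set carrying
    [beta_0, ..., beta_n]. Fix a finite set [E], and let [F] be the finite set
    of points reached from [E] in at most [m] steps by elements of [T]. Assume
    that all [beta_k] with [k > n] equalize [F] up to [delta]. For a harmonic
    function with values in [[0, C]] let [omega_i] bound its oscillation on the
    points from which [i] steps of [T] stay in [F]. One step of the harmonic
    equation gives
    [omega_(i+1) <= (1 - c_(n+1)) omega_i + C delta]:
    the components of index at most [n] move both points by the same element of
    [T], and the later ones nearly identify the two points. Iterating, the
    oscillation on [E] is at most
    [(1 - c_(n+1))^m C + C delta / c_(n+1)] ([contraction]).

    Here [m] depends on [n] only, [F] on [T] and [m], and [beta_(n+1)] may be
    selected after [F]; so the [beta_k] can be constructed recursively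
    ([mixing_sequence]) in such a way that the bound above tends to [0] while
    [E = K_n] exhausts [X]. A bounded harmonic function is made nonnegative by
    adding a constant ([harmonic_shift]), so that all the sums in the argument
    are sums of nonnegative terms. *)

(** * Sums of nonnegative families *)

Lemma esumZl (R : realType) (T : choiceType) (I : set T) (r : R)
    (a : T -> \bar R) :
  0 <= r -> (forall i, 0 <= a i)%E ->
  (\esum_(i in I) (r%:E * a i) = r%:E * \esum_(i in I) a i)%E.
Proof.
move=> r0 a0; rewrite /esum -ereal_supZl//; last first.
  by apply/set0P; exists (\sum_(i \in set0) a i)%E; exists set0;
     first exact: fsets_set0.
congr ereal_sup; rewrite image_comp; apply: eq_imagel => A _ /=.
by rewrite ge0_mule_fsumr.
Qed.

Lemma esum_exchange (R : realType) (T U : choiceType) (a : T -> U -> \bar R) :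
  (forall i j, 0 <= a i j)%E ->
  (\esum_(i in [set: T]) \esum_(j in [set: U]) a i j =
   \esum_(j in [set: U]) \esum_(i in [set: T]) a i j)%E.
Proof.
move=> a0; rewrite !esum_esum//.
rewrite (@reindex_esum R _ _ ([set: U] `*`` (fun=> [set: T])) _
  (fun p : U * T => (p.2, p.1)))//.
split=> //=.
- by move=> [u t] [u' t'] _ _ /= [-> ->].
- by move=> [t u] _; exists (u, t).
Qed.

Lemma esum_delta (R : realType) (T : choiceType) (x : T) (a : T -> \bar R) :
  (forall i, 0 <= a i)%E ->
  (\esum_(y in [set: T]) ((x == y)%:R%:E * a y) = a x)%E.
Proof.
move=> a0; rewrite -(esum_set1 (t := x) (a := a))// [RHS]esum_mkcond.
apply: eq_esum => y _; rewrite classical_sets.in_set1 eq_sym.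
by case: eqP => _; rewrite ?mul1e ?mul0e.
Qed.

(** Weights in [[0, 1]] have average at most 1 under a probability. *)
Lemma esum_mass_le1 (R : realType) (T : choiceType) (p w : T -> R) :
  (forall i, 0 <= p i) -> (forall i, 0 <= w i <= 1) ->
  (\esum_(i in [set: T]) (p i)%:E = 1)%E ->
  (\esum_(i in [set: T]) (w i * p i)%:E <= 1)%E.
Proof.
move=> p0 w01 <-; apply: le_esum => i _; rewrite lee_fin.
by have /andP[_ w1] := w01 i; rewrite ler_piMl.
Qed.

Lemma le1_fineK (R : realType) (e : \bar R) :
  (0 <= e)%E -> (e <= 1)%E -> (fine e)%:E = e.
Proof.
by move=> e0 e1; rewrite fineK// ge0_fin_numE// (le_lt_trans e1)// ltry.
Qed.

(** * Averaging along the action *)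

Section averaging.
Variables (R : realType) (G : groupType) (X : choiceType) (act : G -> X -> X).
Implicit Types (mu nu : G -> R) (h f : X -> R) (u v w x y : X).

(** The value at [x] of the Markov operator of [mu] applied to the nonnegative
    function [h], that is the sum over [g] of [mu g * h (g . x)]. *)
Definition mean mu h x : \bar R :=
  \esum_(g in [set: G]) (mu g * h (act g x))%:E.

Lemma inducedE mu x y : is_probability mu ->
  ((induced act mu x y)%:E =
   \esum_(g in [set: G]) ((act g x == y)%:R * mu g)%:E)%E.
Proof.
move=> [mu0 mu1]; rewrite /induced le1_fineK//.
  by apply: esum_ge0 => g _; rewrite lee_fin mulr_ge0.
by apply: esum_mass_le1 => // g; case: eqP; rewrite ?lexx ?ler01.
Qed.

Lemma induced_ge0 mu x y : is_probability mu -> 0 <= induced act mu x y.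
Proof.
move=> mup; rewrite -lee_fin inducedE//; apply: esum_ge0 => g _.
by rewrite lee_fin mulr_ge0//; case: mup.
Qed.

Lemma esum_induced mu h x : is_probability mu -> (forall y, 0 <= h y) ->
  (\esum_(y in [set: X]) (h y * induced act mu x y)%:E = mean mu h x)%E.
Proof.
move=> mup h0; have mu0 : forall g, 0 <= mu g by case: mup.
rewrite (eq_esum (b := fun y => \esum_(g in [set: G])
    ((act g x == y)%:R%:E * (mu g * h y)%:E)%E)); last first.
  move=> y _; rewrite EFinM inducedE// -esumZl//; last first.
    by move=> g; rewrite lee_fin mulr_ge0.
  by apply: eq_esum => g _; rewrite -!EFinM; congr _%:E; ring.
rewrite esum_exchange; last first.
  by move=> y g; rewrite -EFinM lee_fin !mulr_ge0.
apply: eq_esum => g _.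
rewrite (esum_delta (act g x) (a := fun y => (mu g * h y)%:E))//.
by move=> y; rewrite lee_fin mulr_ge0.
Qed.

Lemma mean_cst mu c x : is_probability mu -> 0 <= c ->
  mean mu (fun=> c) x = c%:E.
Proof.
move=> [mu0 mu1] c0; rewrite /mean.
under eq_esum => g _ do rewrite mulrC EFinM.
by rewrite esumZl ?mu1 ?mule1.
Qed.

Lemma mean_ge0 mu h x : is_probability mu -> (forall y, 0 <= h y) ->
  (0 <= mean mu h x)%E.
Proof.
by move=> [mu0 _] h0; apply: esum_ge0 => g _; rewrite lee_fin mulr_ge0.
Qed.

(** Adding a constant turns a bounded harmonic function into a nonnegative
    one, for which the harmonic equation involves a single unsigned sum. *)
Lemma harmonic_shift mu f (M : R) : is_probability mu -> harmonic act mu f ->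
  (forall x, `|f x| <= M) ->
  forall x, (f x + M)%:E = mean mu (fun y => f y + M) x.
Proof.
move=> mup fharm fM x.
have M0 : 0 <= M by apply: le_trans (fM x).
have fM0 y : 0 <= f y + M by have := fM y; rewrite ler_norml => /andP[]; lra.
have [] := fharm x; set a := (fun y => _) => asum fxE.
have := asum => /summable_funepos; have := asum => /summable_funeneg.
rewrite /summable.
under eq_esum do rewrite gee0_abs//.
set n := (\esum_(y in _) _)%E => noo.
under eq_esum do rewrite gee0_abs//.
set p := (\esum_(y in _) _)%E => poo.
have nfin : n \is a fin_num by rewrite ge0_fin_numE//; apply: esum_ge0.
rewrite -esum_induced// EFinD fxE -/n -/p -(mean_cst x mup M0) -esum_induced//.
rewrite addeAC -[RHS](addeK _ nfin); congr (_ - _)%E.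
rewrite -esumD//; last by move=> y _; rewrite lee_fin mulr_ge0// induced_ge0.
rewrite -esumD//; last by move=> y _; rewrite lee_fin mulr_ge0// induced_ge0.
apply: eq_esum => y _; rewrite funeposE funenegE /a mulrDl.
rewrite -EFinN -!EFin_max -!EFinD; congr _%:E.
by case: (leP (f y * induced act mu x y) 0) => ?; case: leP => ?; lra.
Qed.

(** The total variation, in the l1 normalization, between the measures
    [nu . u] and [nu . v] on [X]. *)
Definition l1dist nu u v : \bar R :=
  l1norm (fun z : X => (induced act nu u z - induced act nu v z)%R).

Lemma l1dist_refl nu u : l1dist nu u u = 0%E.
Proof. by apply: esum1 => z _; rewrite subrr normr0. Qed.

Lemma l1dist_sym nu u v : l1dist nu u v = l1dist nu v u.
Proof. by apply: eq_esum => z _; rewrite distrC. Qed.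

Lemma l1dist_triangle nu u v w :
  (l1dist nu u w <= l1dist nu u v + l1dist nu v w)%E.
Proof.
rewrite /l1dist /l1norm -esumD//; apply: le_esum => z _.
by rewrite -EFinD lee_fin ler_distD.
Qed.

(** Bounded functions are averaged almost equally from points that [nu]
    equalizes. *)
Lemma mean_le_l1dist nu h (C : R) u v : is_probability nu ->
  (forall y, 0 <= h y <= C) ->
  (mean nu h u <= mean nu h v + C%:E * l1dist nu u v)%E.
Proof.
move=> nup hC; have h0 y : 0 <= h y by case/andP: (hC y).
have C0 : 0 <= C by case/andP: (hC u) => /le_trans; apply.
rewrite -!esum_induced// /l1dist /l1norm -esumZl// -esumD//; last 2 first.
- by move=> y _; rewrite lee_fin mulr_ge0// induced_ge0.
- by move=> y _; rewrite -EFinM lee_fin mulr_ge0.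
apply: le_esum => y _; rewrite -EFinM -EFinD lee_fin -lerBlDl -mulrBr.
rewrite (le_trans (ler_norm _))// normrM ler_wpM2r//.
by rewrite ger0_norm//; case/andP: (hC y).
Qed.

Lemma mean_le_pointwise mu h (w : R) u v :
  is_probability mu -> (forall y, 0 <= h y) -> 0 <= w ->
  (forall g, 0 < mu g -> h (act g u) <= h (act g v) + w) ->
  (mean mu h u <= mean mu h v + w%:E)%E.
Proof.
move=> mup h0 w0 hw; have [mu0 _] := mup.
rewrite -(mean_cst v mup w0) /mean -esumD; last 2 first.
- by move=> g _; rewrite lee_fin mulr_ge0.
- by move=> g _; rewrite lee_fin mulr_ge0.
apply: le_esum => g _; rewrite -EFinD lee_fin -mulrDr.
have [mug|] := ltP 0 (mu g); first by rewrite ler_wpM2l// hw.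
move=> mug; have -> : mu g = 0 by apply/le_anti; rewrite mug mu0.
by rewrite !mul0r.
Qed.

End averaging.

(** * Countable mixtures *)

Lemma is_probability_le1 (R : realType) (G : groupType)
    (mu : G -> R) g :
  is_probability mu -> mu g <= 1.
Proof.
move=> [mu0 mu1]; rewrite -lee_fin -mu1.
rewrite -(esum_delta g (a := fun g => (mu g)%:E))//; apply: le_esum => g' _.
by case: eqP; rewrite ?mul1e// mul0e lee_fin.
Qed.

Section mixture.
Variables (R : realType) (G : groupType) (X : choiceType) (act : G -> X -> X).
Variables (c : nat -> R) (beta : nat -> G -> R).
Hypothesis c_gt0 : forall k, 0 < c k.
Hypothesis c_sum1 : (\esum_(k in [set: nat]) (c k)%:E = 1)%E.
Hypothesis beta_prob : forall k, is_probability (beta k).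

(** The mass function of the convex combination of the [beta k] with weights
    [c k]. The sums are at most 1, so that [fine] discards nothing. *)
Definition mixture (g : G) : R :=
  fine (\esum_(k in [set: nat]) (c k * beta k g)%:E).

Let c_ge0 k : 0 <= c k. Proof. exact: ltW. Qed.
Let beta_ge0 k g : 0 <= beta k g. Proof. by case: (beta_prob k). Qed.

Lemma mixtureE g :
  ((mixture g)%:E = \esum_(k in [set: nat]) (c k * beta k g)%:E)%E.
Proof.
rewrite /mixture le1_fineK//.
  by apply: esum_ge0 => k _; rewrite lee_fin mulr_ge0.
under eq_esum do rewrite mulrC.
by apply: esum_mass_le1 => // k; rewrite beta_ge0 is_probability_le1.
Qed.

Lemma mean_mixture (h : X -> R) x : (forall y, 0 <= h y) ->
  (mean act mixture h x =
   \esum_(k in [set: nat]) ((c k)%:E * mean act (beta k) h x))%E.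
Proof.
move=> h0; rewrite /mean.
rewrite (eq_esum (b := fun g => \esum_(k in [set: nat])
    (c k * (beta k g * h (act g x)))%:E)); last first.
  move=> g _; rewrite mulrC EFinM mixtureE -esumZl//; last first.
    by move=> k; rewrite lee_fin mulr_ge0.
  by apply: eq_esum => k _; rewrite -EFinM; congr _%:E; ring.
rewrite esum_exchange; last by move=> g k; rewrite lee_fin !mulr_ge0.
apply: eq_esum => k _; rewrite -esumZl//.
by move=> g; rewrite lee_fin mulr_ge0.
Qed.

Lemma mixture_gt0 k g : 0 < beta k g -> 0 < mixture g.
Proof.
move=> bg; rewrite -lte_fin mixtureE (@lt_le_trans _ _ (c k * beta k g)%:E)//.
  by rewrite lte_fin mulr_gt0.
rewrite -(esum_delta k (a := fun k => (c k * beta k g)%:E)); last first.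
  by move=> j; rewrite lee_fin mulr_ge0.
apply: le_esum => j _; case: eqP; rewrite ?mul1e// mul0e lee_fin.
by rewrite mulr_ge0.
Qed.

Lemma mixture_prob : is_probability mixture.
Proof.
split=> [g|].
  by rewrite -lee_fin mixtureE; apply: esum_ge0 => k _; rewrite lee_fin mulr_ge0.
under eq_esum do rewrite mixtureE.
rewrite esum_exchange; last by move=> g k; rewrite lee_fin mulr_ge0.
rewrite -[RHS]c_sum1; apply: eq_esum => k _.
under eq_esum do rewrite EFinM.
rewrite esumZl ?(beta_prob k).2 ?mule1//.
by move=> g; rewrite lee_fin.
Qed.

End mixture.

(** * The contraction estimate *)

Section contraction.
Variables (R : realType) (G : groupType) (X : choiceType) (act : G -> X -> X).

(** The points obtained from [E] by applying successively at most [i] elements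
    of [T]. *)
Fixpoint reach (T : seq G) (i : nat) (E : seq X) : seq X :=
  if i is j.+1 then reach T j (E ++ [seq act g x | g <- T, x <- E]) else E.

Lemma sub_reach T i E : {subset E <= reach T i E}.
Proof.
elim: i E => [|i IHi] E x xE //=.
by apply: IHi; rewrite mem_cat xE.
Qed.

Variables (c : nat -> R) (beta : nat -> G -> R).
Hypothesis c_gt0 : forall k, 0 < c k.
Hypothesis c_sum1 : (\esum_(k in [set: nat]) (c k)%:E = 1)%E.
Hypothesis beta_prob : forall k, is_probability (beta k).

Let c_ge0 k : 0 <= c k. Proof. exact: ltW. Qed.

Lemma sum_weights_but n :
  (\esum_(k in [set: nat]) ((n != k)%:R * c k)%:E = (1 - c n)%:E)%E.
Proof.
have cfin : (c n)%:E \is a fin_num by [].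
rewrite -[LHS](addeK _ cfin) EFinB; congr (_ - _)%E.
rewrite -(esum_delta n (a := fun k => (c k)%:E))// -esumD; last 2 first.
- by move=> k _; rewrite lee_fin mulr_ge0.
- by move=> k _; rewrite -EFinM lee_fin mulr_ge0.
rewrite -[RHS]c_sum1; apply: eq_esum => k _.
by rewrite -EFinM -EFinD -mulrDl; case: eqP => _; rewrite ?(add0r, addr0) mul1r.
Qed.

(** As [n.+1] is not among them, the indices at most [n] have total weight at
    most [1 - c n.+1]. *)
Lemma mixture_head_tail n (w d : R) : 0 <= w -> 0 <= d ->
  (\esum_(k in [set: nat]) ((c k)%:E * (if (k <= n)%N then w else d)%:E)
   <= ((1 - c n.+1) * w + d)%:E)%E.
Proof.
move=> w0 d0.
have -> : ((1 - c n.+1) * w + d)%:E = (w%:E *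
    (\esum_(k in [set: nat]) ((n.+1 != k)%:R * c k)%:E) +
    d%:E * \esum_(k in [set: nat]) (c k)%:E)%E.
  by rewrite sum_weights_but c_sum1 mule1 -EFinM -EFinD mulrC.
rewrite -!esumZl//; last by move=> k; rewrite lee_fin mulr_ge0.
rewrite -esumD; last 2 first.
- by move=> k _; rewrite -EFinM lee_fin !mulr_ge0.
- by move=> k _; rewrite -EFinM lee_fin mulr_ge0.
apply: le_esum => k _; rewrite -!EFinM -EFinD lee_fin.
case: leqP => kn; last by rewrite mulrC lerDr !mulr_ge0.
have -> : (n.+1 != k) by rewrite neq_ltn ltnS kn orbT.
by rewrite mul1r mulrC lerDl mulr_ge0.
Qed.

(** Components of index at most [n] are carried by [T], later ones equalize [F]
    up to [delta]. If [i] steps of [T] from [E] stay in [F], then the oscillation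
    of the harmonic function [h] on [E] is at most the stated bound, which is
    the [i]-th iterate of [w |-> (1 - c n.+1) * w + C * delta] started from
    [C] plus the fixed point of this map. *)
Lemma contraction (h : X -> R) (C delta : R) (T : seq G) (F : seq X) n :
  (forall y, 0 <= h y <= C) -> 0 <= delta ->
  (forall x, (h x)%:E = mean act (mixture c beta) h x) ->
  (forall k g, (k <= n)%N -> 0 < beta k g -> g \in T) ->
  (forall k u v, (n < k)%N -> u \in F -> v \in F ->
    (l1dist act (beta k) u v <= delta%:E)%E) ->
  forall i E, {subset reach T i E <= F} ->
  forall u v, u \in E -> v \in E ->
  h u <= h v + ((1 - c n.+1) ^+ i * C + C * delta / c n.+1).
Proof.
move=> hC delta0 hharm head tail; elim=> [|i IHi] E reachF u v uE vE.
  have /andP[hv _] := hC v; have /andP[_ hu] := hC u.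
  have : 0 <= C * delta / c n.+1.
    by rewrite divr_ge0// mulr_ge0// (le_trans hv)//; case/andP: (hC v).
  by rewrite expr0; lra.
have h0 y : 0 <= h y by case/andP: (hC y).
have C0 : 0 <= C by case/andP: (hC u) => /le_trans; apply.
have c1 : c n.+1 <= 1.
  rewrite -subr_ge0 -lee_fin -sum_weights_but; apply: esum_ge0 => k _.
  by rewrite lee_fin mulr_ge0.
set w := (1 - c n.+1) ^+ i * C + C * delta / c n.+1 in IHi.
have w0 : 0 <= w.
  by rewrite addr_ge0 ?divr_ge0 ?mulr_ge0// exprn_ge0// subr_ge0.
have -> : (1 - c n.+1) ^+ i.+1 * C + C * delta / c n.+1 =
    (1 - c n.+1) * w + C * delta.
  by rewrite /w exprS; field; rewrite gt_eqF.
rewrite -lee_fin EFinD !hharm !mean_mixture//.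
have tl := mixture_head_tail n w0 (mulr_ge0 C0 delta0).
refine (le_trans _ (leeD2l _ tl)).
rewrite -esumD; last 2 first.
- by move=> k _; rewrite mule_ge0// ?lee_fin// mean_ge0.
- by move=> k _; rewrite -EFinM lee_fin mulr_ge0//; case: ifP; rewrite // mulr_ge0.
apply: le_esum => k _; rewrite -ge0_muleDr; last 2 first.
- exact: mean_ge0.
- by rewrite lee_fin; case: ifP; rewrite // mulr_ge0.
apply: lee_wpmul2l; first by rewrite lee_fin.
case: leqP => kn.
  (* an element of T moves both points to the next layer *)
  apply: mean_le_pointwise => // g bg.
  by apply: (IHi _ reachF); rewrite mem_cat; apply/orP; right;
     apply: allpairs_f => //; apply: head bg.
have EF : {subset E <= F} by move=> x xE; apply: reachF; apply: sub_reach.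
apply: (le_trans (mean_le_l1dist act u v (beta_prob k) hC)).
by rewrite leeD2l// EFinM lee_wpmul2l ?lee_fin// tail// EF.
Qed.

End contraction.

(** * Almost invariant measures equalize finite sets *)

Lemma near_seq (T : eqType) (I : Type) (F : set_system I) (FF : Filter F)
    (s : seq T) (P : I -> T -> Prop) :
  (forall x, x \in s -> \forall i \near F, P i x) ->
  \forall i \near F, forall x, x \in s -> P i x.
Proof.
elim: s => [|a s IHs] Ps; first by apply: nearW.
have Ps' : forall x, x \in s -> \forall i \near F, P i x.
  by move=> x xs; apply: Ps; rewrite in_cons xs orbT.
have Pa := Ps a (mem_head _ _); move: (IHs Ps') Pa.
apply: filterS2 => i Pis Pia x; rewrite in_cons => /predU1P[->//|].
exact: Pis.
Qed.

Section invariance.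
Variables (R : realType) (G : groupType) (X : choiceType) (act : G -> X -> X).
Implicit Types (nu : G -> R) (u v : X).
Variables (S : set G) (K : nat -> set X) (eps : nat -> R).
Hypothesis S_generates : generates S.
Hypothesis act_action : is_left_action act.
Hypothesis act_transitive : transitive_action act.
Hypothesis K_increasing : forall m n : nat, (m <= n)%N -> K m `<=` K n.
Hypothesis K_exhausts : \bigcup_(n in [set: nat]) K n = [set: X].
Hypothesis eps_cvg0 : eps @ \oo --> (0 : R).

(** The measure [nu] equalizes up to [eps n] any two points of [K n] joined by
    an element of [S]. *)
Definition almost_inv n nu := forall x y : X, K n x -> K n y ->
  (exists s : G, S s /\ y = act s x) -> (l1dist act nu x y < (eps n)%:E)%E.

Lemma near_K x : \forall n \near \oo, K n x.
Proof.
have : [set: X] x by []; rewrite -K_exhausts => -[m _ Kmx].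
by exists m => // n /= mn; apply: K_increasing Kmx.
Qed.

(** The elements [g] for which all pairs [(x, g . x)] are eventually equalized
    form a subgroup containing [S], hence the whole group; transitivity then
    gives all pairs of points. *)
Lemma near_l1dist u v (e : R) : 0 < e ->
  \forall n \near \oo, forall nu, almost_inv n nu ->
    (l1dist act nu u v <= e%:E)%E.
Proof.
pose H := [set g : G | forall x (d : R), 0 < d ->
  \forall n \near \oo, forall nu, almost_inv n nu ->
    (l1dist act nu x (act g x) <= d%:E)%E].
have [act1 actM] := act_action.
suff HT : H = [set: G].
  have [g <-] := act_transitive u v; have : H g by rewrite HT.
  by move=> Hg; apply: Hg.
apply: S_generates.
- by move=> x d d0; apply: nearW => n nu _; rewrite act1 l1dist_refl lee_fin ltW.
- move=> g g' Hg Hg' x d d0; have d20 : 0 < d / 2 by rewrite divr_gt0.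
  move: (Hg' x _ d20) (Hg (act g' x) _ d20); apply: filterS2 => n le1 le2 nu nun.
  rewrite actM (le_trans (l1dist_triangle _ _ _ (act g' x) _))//.
  apply: le_trans (leeD (le1 nu nun) (le2 nu nun)) _.
  by rewrite -EFinD -splitr.
- move=> g Hg x d d0; move: (Hg (act g^-1%g x) _ d0).
  apply: filterS => n le1 nu nun; have := le1 nu nun.
  by rewrite -actM mulgV act1 l1dist_sym.
- move=> s Ss x d d0.
  have epsd : \forall n \near \oo, eps n < d.
    move/cvgrPdist_lt: eps_cvg0 => /(_ _ d0); apply: filterS => n.
    by rewrite sub0r normrN; apply: le_lt_trans; exact: ler_norm.
  near=> n => nu nun; apply: (@le_trans _ _ (eps n)%:E).
    apply/ltW/nun; [near: n; exact: near_K | near: n; exact: near_K|].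
    by exists s.
  by rewrite lee_fin ltW//; near: n.
Unshelve. all: by end_near.
Qed.

Lemma near_l1dist_seq (F : seq X) (e : R) : 0 < e ->
  \forall n \near \oo, forall nu, almost_inv n nu ->
    forall u v, u \in F -> v \in F -> (l1dist act nu u v <= e%:E)%E.
Proof.
move=> e0; have : \forall n \near \oo, forall u, u \in F -> forall v, v \in F ->
    forall nu, almost_inv n nu -> (l1dist act nu u v <= e%:E)%E.
  by apply: near_seq => u _; apply: near_seq => v _; apply: near_l1dist.
by apply: filterS => n H nu nun u v uF vF; apply: H.
Qed.

End invariance.

(** * Construction of the components *)

(** The identity is added to [s] so that the support is never empty; repeated
    elements of [s] are counted with multiplicity. *)
Lemma uniform_probability (R : realType) (G : groupType) (s : seq G) :
  exists mu : G -> R,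
  [/\ is_probability mu, forall g, g \in s -> 0 < mu g &
      forall g, 0 < mu g -> g \in 1%g :: s].
Proof.
pose t := 1%g :: s; pose w : R := (size t)%:R^-1.
have w0 : 0 < w by rewrite invr_gt0 ltr0n.
exists (fun g => \sum_(a <- t) (a == g)%:R * w).
have mu0 g : 0 <= \sum_(a <- t) (a == g)%:R * w.
  by apply: sumr_ge0 => a _; rewrite mulr_ge0// ltW.
split=> [|g gs|g].
- split=> //; under eq_esum do rewrite -sumEFin.
  rewrite esum_sum; last by move=> g a _ _; rewrite lee_fin mulr_ge0// ltW.
  transitivity (\sum_(a <- t) w%:E)%E.
    apply: eq_bigr => a _; rewrite -[RHS](esum_delta a (a := fun=> w%:E))//.
    by move=> _; rewrite lee_fin ltW.
  rewrite sumEFin big_const_seq count_predT iter_addr_0 -mulr_natl.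
  by rewrite mulfV// pnatr_eq0.
- have gt : g \in t by rewrite in_cons gs orbT.
  rewrite (big_rem g)//= eqxx mul1r ltr_pwDl//.
  by apply: sumr_ge0 => a _; rewrite mulr_ge0// ltW.
- apply: contraPT => gt; rewrite big_seq big1 ?ltxx// => a at_.
  rewrite (_ : (a == g) = false) ?mul0r//.
  by apply: contraNF gt => /eqP <-.
Qed.

Lemma esum_half_pow (R : realType) :
  (\esum_(k in [set: nat]) (2^-1 ^+ k.+1 : R)%:E = 1)%E.
Proof.
rewrite -nneseries_esumT; last by move=> k; rewrite lee_fin exprn_ge0// invr_ge0.
have := @cvg_geometric_eseries_half R 1 0; rewrite expr0 divr1 => /cvg_lim <-//.
congr (limn _); apply/funext => n; apply: eq_bigr => k _.
by rewrite addn1 mul1r exprVn natrX.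
Qed.

Lemma near_expr_lt (R : realType) (z e : R) : `|z| < 1 -> 0 < e ->
  \forall n \near \oo, z ^+ n < e.
Proof.
move=> z1 e0; move/cvgrPdist_lt: (cvg_expr z1) => /(_ _ e0); apply: filterS => n.
by rewrite sub0r normrN; apply: le_lt_trans; exact: ler_norm.
Qed.

(** Recursive choice of the components. The state after [n] steps is a set [T n]
    carrying [beta 0, ..., beta n], together with a set [F n] containing the
    points reached from [E n] in at most [m n] steps of [T n]; then [beta n.+1]
    equalizes [F n]. As the [F n] increase and the [delta n] decrease, every
    later component equalizes [F n] up to [delta n] as well. *)
Lemma mixing_sequence (R : realType) (G : groupType) (X : choiceType)
    (act : G -> X -> X) (beta0 : G -> R) (T0 : seq G) (m : nat -> nat)
    (delta : nat -> R) (E : nat -> seq X) :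
  is_probability beta0 -> (forall g, 0 < beta0 g -> g \in T0) ->
  (forall k, 0 < delta k) -> (forall i j, (i <= j)%N -> delta j <= delta i) ->
  (forall (F : seq X) (d : R), 0 < d -> exists nu : G -> R,
    [/\ is_probability nu, finite_set (supp nu) &
        forall u v, u \in F -> v \in F -> (l1dist act nu u v <= d%:E)%E]) ->
  exists (beta : nat -> G -> R) (T : nat -> seq G) (F : nat -> seq X),
    [/\ beta 0%N = beta0, forall k, is_probability (beta k),
        forall k n g, (k <= n)%N -> 0 < beta k g -> g \in T n,
        forall n, {subset reach act (T n) (m n) (E n) <= F n} &
        forall n k u v, (n < k)%N -> u \in F n -> v \in F n ->
          (l1dist act (beta k) u v <= (delta n)%:E)%E].
Proof.
move=> beta0p T0P delta0 deltaS nuP.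
have /choice[next nextP] : forall p : nat * seq X, exists q : (G -> R) * seq G,
    [/\ is_probability q.1, forall g, 0 < q.1 g -> g \in q.2 &
        forall u v, u \in p.2 -> v \in p.2 ->
          (l1dist act q.1 u v <= (delta p.1)%:E)%E].
  move=> [n F] /=; have [nu [nup /finite_seqP[s sE] nuF]] := nuP F _ (delta0 n).
  exists (nu, s); split=> //= g nug.
  by have : [set` s] g by rewrite -sE.
pose st := fix st n : seq G * seq X := if n is n'.+1 then
    let T := (st n').1 ++ (next (n', (st n').2)).2 in
    (T, (st n').2 ++ reach act T (m n) (E n))
  else (T0, reach act T0 (m 0%N) (E 0%N)).
pose beta k := if k is k'.+1 then (next (k', (st k').2)).1 else beta0.
have TS i j : (i <= j)%N -> {subset (st i).1 <= (st j).1}.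
  move=> /subnK <-; elim: (j - i)%N => [//|d IHd] g /IHd gd /=.
  by rewrite mem_cat gd.
have FS i j : (i <= j)%N -> {subset (st i).2 <= (st j).2}.
  move=> /subnK <-; elim: (j - i)%N => [//|d IHd] g /IHd gd /=.
  by rewrite mem_cat gd.
exists beta, (fun n => (st n).1), (fun n => (st n).2); split=> //.
- by case=> [//|k] /=; case: (nextP (k, (st k).2)).
- move=> k n g kn bg; apply: TS kn _ _; case: k bg => [|k]; first exact: T0P.
  by rewrite /= mem_cat => bg; case: (nextP (k, (st k).2)) => _ -> //; rewrite orbT.
- by case=> [|n] x //= xr; rewrite mem_cat xr orbT.
- move=> n [//|k] u v; rewrite ltnS => nk uF vF.
  case: (nextP (k, (st k).2)) => _ _ /= le_delta.
  apply: le_trans (le_delta _ _ (FS _ _ nk _ uF) (FS _ _ nk _ vF)) _.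
  by rewrite lee_fin deltaS.
Qed.

Theorem lemma2 (R : realType) (G : groupType) (S : set G) (X : countType)
    (act : G -> X -> X) (K : nat -> set X) (eps : nat -> R)
    (S_finite : finite_set S) (S_generates : generates S)
    (act_action : is_left_action act) (act_transitive : transitive_action act)
    (K_finite : forall n : nat, finite_set (K n))
    (K_increasing : forall m n : nat, (m <= n)%N -> K m `<=` K n)
    (K_exhausts : \bigcup_(n in [set: nat]) K n = [set: X])
    (eps_decreasing : forall m n : nat, (m <= n)%N -> eps n <= eps m)
    (eps_cvg0 : eps @ \oo --> (0 : R))
    (almost_invariant : forall n : nat, exists nu : G -> R,
      [/\ is_probability nu,
          finite_set (supp nu) &
          forall x y : X, K n x -> K n y ->
            (exists s : G, S s /\ y = act s x) ->
            (l1norm (fun z : X => (induced act nu x z - induced act nu y z)%R)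
               < (eps n)%:E)%E]) :
  exists mu : G -> R,
    [/\ is_probability mu, nondegenerate mu & liouville act mu].
Proof.
have [s sE] : exists s : seq G, S = [set` s] by apply/finite_seqP.
have /choice[Ks KsE] : forall n, exists t : seq X, K n = [set` t].
  by move=> n; apply/finite_seqP.
have [beta0 [beta0p beta0s beta0T]] := uniform_probability R s.
pose half : R := 2^-1.
have half0 : 0 < half by rewrite invr_gt0.
have half1 : half < 1 by rewrite invf_lt1// ltr1n.
pose c k := half ^+ k.+1.
have c0 k : 0 < c k by rewrite exprn_gt0.
have csum : (\esum_(k in [set: nat]) (c k)%:E = 1)%E by exact: esum_half_pow.
have /choice[m mP] : forall n, exists m, (1 - c n.+1) ^+ m < half ^+ n.
  move=> n; have cn1 : c n.+1 <= 1 by rewrite exprn_ile1// ltW.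
  have z1 : `|1 - c n.+1| < 1.
    by rewrite ger0_norm ?subr_ge0// ltrBlDr ltrDl.
  by case: (near_expr_lt z1 (exprn_gt0 n half0)) => m _ mP; exists m; apply: mP => /=.
(* with this choice the two terms of the contraction bound at n are each at
   most C 2^-n *)
pose delta n := half ^+ n * c n.+1.
have delta0 n : 0 < delta n by rewrite mulr_gt0// exprn_gt0.
have deltaS i j : (i <= j)%N -> delta j <= delta i.
  move=> ij; have le_half a b : (a <= b)%N -> half ^+ b <= half ^+ a.
    by move=> ab; rewrite ler_wiXn2l// ltW.
  by rewrite ler_pM ?exprn_ge0 ?le_half// ltW.
have [|beta [T [F [beta00 betap headT reachF tailF]]]] :=
  @mixing_sequence R G X act beta0 _ m delta Ks beta0p beta0T delta0 deltaS.
  move=> F d d0.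
  have [n _ nP] := near_l1dist_seq S_generates act_action act_transitive
    K_increasing K_exhausts eps_cvg0 F d0.
  have [nu [nup nufin nuinv]] := almost_invariant n.
  by exists nu; split=> //; apply: (nP n (leqnn n)).
exists (mixture c beta).
have mup : is_probability (mixture c beta) by exact: mixture_prob.
split=> //.
  move=> H H1 HM HV HS; apply: S_generates => // g Sg; apply: HS.
  apply: (mixture_gt0 c0 csum betap (k := 0%N)).
  by rewrite beta00; apply: beta0s; move: Sg; rewrite sE.
move=> f /pinfty_ex_gt0[M M_gt0 /= fM] fharm.
have {}fM x : `|f x| <= M by exact: fM.
suff le_f x y : f x <= f y by move=> x y; apply/le_anti; rewrite !le_f.
pose h z := f z + M; pose C := 2 * M.
have hC z : 0 <= h z <= C.
  by have := fM z; rewrite ler_norml /h /C => /andP[? ?]; apply/andP; split; lra.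
have hharm := harmonic_shift mup fharm fM.
rewrite -(lerD2r M); apply/ler_addgt0Pr => e e0.
have e'0 : 0 < e / (2 * C + 1) by rewrite divr_gt0// /C; lra.
have half1' : `|half| < 1 by rewrite ger0_norm// ltW.
near \oo => n.
have xn : x \in Ks n.
  by have : K n x by [near: n; exact: near_K]; rewrite KsE.
have yn : y \in Ks n.
  by have : K n y by [near: n; exact: near_K]; rewrite KsE.
have halfn : half ^+ n < e / (2 * C + 1) by near: n; exact: near_expr_lt.
have := contraction c0 csum betap hC (ltW (delta0 n)) hharm
  (fun k g => headT k n g) (tailF n) (reachF n) xn yn.
rewrite /h => /le_trans; apply; rewrite lerD2l.
have -> : C * delta n / c n.+1 = half ^+ n * C.
  by rewrite /delta; field; rewrite gt_eqF.
have C0 : 0 <= C by rewrite /C; lra.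
have := mP n; move: halfn; rewrite ltr_pdivlMr; last by lra.
have := exprn_gt0 n half0; set a := half ^+ n; set b := _ ^+ m n => a0 ha ba.
have : b * C <= a * C by rewrite ler_wpM2r// ltW.
by lra.
Unshelve. all: by end_near.
Qed.
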